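(* Let $g$ be a probability kernel on a countable alphabet $A$ such that $\Gamma(g)>0$. Then, for all $f\in\mathcal{L}$ and all $\theta\in\mathbb{R}$, $$\sup_{x\in\mathcal{X}^-}\mathbb{E}_{P^x}\left[e^{\theta(f-\mathbb{E}_{P^x}[f])}\right]\le \exp\left(\frac{\theta^2\,\Gamma(g)^{-2}}{8}\,\|\underline{\delta}(f)\|_2^2\right).$$ As a consequence, for all $u>0$, $$\sup_{x\in\mathcal{X}^-}P^x\left(\left|f-\mathbb{E}_{P^x}[f]\right|>u\right)\le 2\exp\left(-\frac{2u^2}{\Gamma(g)^{-2}\,\|\underline{\delta}(f)\|_2^2}\right).$$
   Context: $A$ is a countable set with the discrete topology; $\mathbb{N}=\{0,1,2,\dots\}$. For integers $i\le j$, $\omega_i^j=(\omega_i,\dots,\omega_j)$ (the empty string if $i>j$). $\mathcal{X}^-=A^{\{\dots,-2,-1\}}$ is the set of left-infinite sequences (pasts). A probability kernel is a function $g:A\times\mathcal{X}^-\to[0,1]$ with $\sum_{s\in A}g(s|x)=1$ for all $x\in\mathcal{X}^-$; for a left-infinite sequence ending at another index $n-1$, $g(\cdot|\cdot)$ denotes the same function after re-indexing (kernels are shift-invariant). For $x\in\mathcal{X}^-$, $P^x$ is the probability measure on $A^{\mathbb{N}}$ specified by $g$ and started with the fixed past $x$: for all $\omega\in A^{\mathbb{N}}$ and $n\ge0$, $P^x([\omega_0^n])=\prod_{j=0}^n g(\omega_j|x\omega_0^{j-1})$, where $x\omega_0^{j-1}$ is the concatenation and $[\omega_0^n]$ the cylinder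 set. For $j\ge1$, $\mathrm{Var}_j(g)=\sup\{\frac12\sum_{a\in A}|g(a|z)-g(a|z')|: z,z'\in\mathcal{X}^-,\ z_k=z'_k\ \forall k\ge -j\}$; $\mathrm{Var}_0(g)=\sup_{z,z'\in\mathcal{X}^-}\frac12\sum_{a\in A}|g(a|z)-g(a|z')|$; and $\Gamma(g)=\prod_{j=0}^\infty(1-\mathrm{Var}_j(g))$. For $f:A^{n+1}\to\mathbb{R}$ and $0\le j\le n$, $\delta_j(f)=\sup\{|f(\omega_0^{j-1}a\,\omega_{j+1}^n)-f(\omega_0^{j-1}b\,\omega_{j+1}^n)|: a,b\in A,\ \omega\in A^{n+1}\}$. $\mathcal{L}=\bigcup_{n\ge0}\mathcal{L}_n$ with $\mathcal{L}_n=\{f:A^{n+1}\to\mathbb{R}: \delta_j(f)<\infty,\ j=0,\dots,n\}$; such $f$ is viewed as a function of the coordinates $0,\dots,n$. $\|\underline{\delta}(f)\|_2^2=\sum_{j=0}^n\delta_j(f)^2$ for $f\in\mathcal{L}_n$. *)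

(* Defs.v *)
From HB Require Import structures.
From mathcomp Require Import all_boot all_order all_algebra.
From mathcomp Require Import all_classical all_reals all_analysis.

Set Implicit Arguments.
Unset Strict Implicit.
Unset Printing Implicit Defensive.

Import Order.TTheory GRing.Theory Num.Theory.
Import numFieldNormedType.Exports.

Local Open Scope classical_set_scope.
Local Open Scope ring_scope.

(* A left-infinite sequence (..., x_{-2}, x_{-1}) is encoded as the function  *)
(* k |-> x_{-(k+1)}, so that index 0 is the most recent symbol.               *)
Definition past (A : Type) := nat -> A.

(* The past x w_0 ... w_{j-1}, re-indexed so as to end at time -1. *)
Definition concat (A : Type) (x : past A) (w : nat -> A) (j : nat) : past A :=
  fun k => if (k < j)%N then w (j - k.+1)%N else x (k - j)%N.

Definition is_kernel (R : realType) (A : choiceType) (g : A -> past A -> R) :=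
  (forall a x, 0 <= g a x <= 1) /\
  (forall x, (\esum_(a in [set: A]) (g a x)%:E = 1)%E).

(* [w_0^n] *)
Definition cylinder (A : Type) (w : nat -> A) (n : nat) : set (nat -> A) :=
  [set w' | forall i, (i <= n)%N -> w' i = w i].

Definition cylinders (A : Type) : set (set (nat -> A)) :=
  [set C | exists w n, C = cylinder w n].
Arguments cylinders : clear implicits.

(* A^N; for a countable discrete A the cylinders generate the product (and    *)
(* Borel) sigma-algebra.                                                      *)
Definition trajectory (A : pointedType) := g_sigma_algebraType (cylinders A).

Definition specified_by (R : realType) (A : pointedType)
    (g : A -> past A -> R) (x : past A)
    (P : probability (trajectory A) R) :=
  forall (w : nat -> A) (n : nat),
    P (cylinder w n) = (\prod_(j < n.+1) g (w j) (concat x w j))%:E.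

Definition tv (R : realType) (A : choiceType) (p q : A -> R) : \bar R :=
  ((2^-1)%:E * \esum_(a in [set: A]) `|p a - q a|%:E)%E.

(* The condition z_k = z'_k for all k >= -j concerns the first j entries of   *)
(* the encoded pasts; for j = 0 it is void.                                   *)
Definition Var (R : realType) (A : choiceType) (g : A -> past A -> R)
    (j : nat) : R :=
  fine (ereal_sup [set r | exists z z' : past A,
    (forall k, (k < j)%N -> z k = z' k) /\ r = tv (g^~ z) (g^~ z')]).

Definition Gamma (R : realType) (A : choiceType) (g : A -> past A -> R) : R :=
  limn (fun n => \prod_(0 <= j < n) (1 - Var g j)).

(* A function on A^{n+1} is a function of w : 'I_n.+1 -> A; dfwith w a is w   *)
(* with its j-th entry replaced by a, where a is given as the j-th entry.     *)
Definition delta (R : realType) (A : Type) (n : nat)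
    (f : ('I_n.+1 -> A) -> R) (j : 'I_n.+1) : \bar R :=
  ereal_sup [set r | exists (w : 'I_n.+1 -> A) (a b : A),
    r = `|f (@dfwith _ (fun=> A) w j a) - f (@dfwith _ (fun=> A) w j b)|%:E].

Definition in_L (R : realType) (A : Type) (n : nat)
    (f : ('I_n.+1 -> A) -> R) :=
  forall j : 'I_n.+1, (delta f j < +oo)%E.

Definition delta_norm2 (R : realType) (A : Type) (n : nat)
    (f : ('I_n.+1 -> A) -> R) : \bar R :=
  (\sum_(j < n.+1) delta f j ^+ 2)%E.

Definition on_traj (R : realType) (A : pointedType) (n : nat)
    (f : ('I_n.+1 -> A) -> R) : trajectory A -> R :=
  fun w => f (fun i : 'I_n.+1 => w i).

(* Main.v *)
Require Import Defs.
From HB Require Import structures.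
From mathcomp Require Import all_boot all_order all_algebra.
From mathcomp Require Import all_classical all_reals all_analysis.
From mathcomp Require Import measurable_realfun ring lra.

(* Integrate f one coordinate at a time, the last first.  The exponential moment
   of each conditional mean, as a function of its last coordinate, is controlled
   by Hoeffding's lemma; its oscillation at coordinate k is at most the expected
   cost sum_j d_(k+j) u_j, where d_i is the oscillation of f at coordinate i and
   u_j bounds the probability that two copies of the process whose pasts
   disagree at time k disagree at time k + j under the maximal coupling of the
   transition laws.  Since the number of past symbols in agreement dominates the
   house-of-cards chain that climbs from l to l + 1 with probability
   1 - Var_l(g), u_j can be taken to be the probability that this chain, started
   from 0, is at 0 at time j.  The expected number of visits to 0 is
   1 / prod_l (1 - Var_l(g)), so sum_j u_j <= 1 / Gamma(g), and Young's
   inequality bounds the sum of the squared oscillations by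
   Gamma(g)^-2 ||delta(f)||_2^2.  No coupling is constructed: the recursion it
   satisfies is proved directly from the duality between total variation and
   oscillation. *)

Set Implicit Arguments.
Unset Strict Implicit.
Unset Printing Implicit Defensive.

Import Order.TTheory GRing.Theory Num.Theory.
Import numFieldNormedType.Exports.

Local Open Scope classical_set_scope.
Local Open Scope ring_scope.

(** * The house-of-cards chain *)

Section HouseOfCards.
Context {R : realType}.
Variable V : nat -> R.
Hypothesis V01 : forall l, 0 <= V l <= 1.

(* The house-of-cards chain climbs from l to l+1 with probability 1 - V l and
   falls to 0 otherwise; visit l j is the probability that it sits at 0 at time
   j when started from l. *)
Fixpoint visit (l j : nat) : R :=
  if j is j'.+1 then (1 - V l) * visit l.+1 j' + V l * visit 0 j'
  else (l == 0)%:R.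

Lemma visit_ge0 l j : 0 <= visit l j.
Proof.
elim: j l => [|j IH] l /=; first by rewrite ler0n.
have /andP[V0 V1] := V01 l.
by rewrite addr_ge0// mulr_ge0// subr_ge0.
Qed.

(* G l plays the part of the probability of never falling from height l. *)
Lemma sum_visit_le (G : nat -> R) (N l : nat) :
  0 < G 0%N -> (forall j, G j <= 1) -> (forall j, G j = (1 - V j) * G j.+1) ->
  \sum_(j < N) visit l j <= (l == 0)%:R + (1 - G l) / G 0%N.
Proof.
move=> G0 G1 GS; elim: N l => [|N IH] l.
  by rewrite big_ord0 addr_ge0 ?ler0n// divr_ge0 ?subr_ge0 ?G1// ltW.
have /andP[V0 V1] := V01 l.
rewrite big_ord_recl /= big_split /= -!mulr_sumr lerD2l.
(* The induction hypothesis at height 0 reads [1 + (1 - G 0) / G 0 = (G 0)^-1]. *)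
apply: (@le_trans _ _ ((1 - V l) * ((1 - G l.+1) / G 0%N) + V l * (G 0%N)^-1)).
  apply: lerD; apply: ler_wpM2l => //; first by rewrite subr_ge0.
    by have := IH l.+1; rewrite add0r.
  apply: le_trans (IH 0%N) _; rewrite le_eqVlt; apply/orP; left; apply/eqP.
  by rewrite /=; field; rewrite gt_eqF.
rewrite [in leRHS](GS l) le_eqVlt; apply/orP; left; apply/eqP.
by field; rewrite gt_eqF.
Qed.

(** Cauchy-Schwarz for weights of total mass at most C: expand the nonnegative sum of
    [u i * (x i - S / C) ^+ 2] and multiply by C. *)
Lemma sum_weighted_sqr_le (I : finType) (u x : I -> R) (C : R) :
  (forall i, 0 <= u i) -> 0 < C -> \sum_i u i <= C ->
  (\sum_i x i * u i) ^+ 2 <= C * \sum_i u i * x i ^+ 2.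
Proof.
move=> u0 C0 uC; set S := \sum_i x i * u i.
have : 0 <= \sum_i u i * (x i - S / C) ^+ 2.
  by apply: sumr_ge0 => i _; rewrite mulr_ge0// sqr_ge0.
rewrite (eq_bigr (fun i => u i * x i ^+ 2 - (2 * S / C) * (x i * u i)
    + (S / C) ^+ 2 * u i)); last by move=> i _; ring.
rewrite !big_split /= sumrN -!mulr_sumr -/S => h.
have h2 : (S / C) ^+ 2 * \sum_i u i <= (S / C) ^+ 2 * C.
  by rewrite ler_wpM2l ?sqr_ge0.
have h3 : 0 <= \sum_i u i * x i ^+ 2 - 2 * S / C * S + (S / C) ^+ 2 * C.
  by apply: le_trans h _; rewrite lerD2l.
rewrite -subr_ge0; have := mulr_ge0 (ltW C0) h3; congr (0 <= _).
by field; rewrite gt_eqF.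
Qed.

(** * Weighted visits and Young's inequality *)

Section Weighted.
Variable d : nat -> R.

(* The expected total cost, from height l, of the visits to 0 at the times
   k + 1, ..., k + r, a visit at time k + 1 + j costing d (k + j). *)
Fixpoint cost (r k l : nat) : R :=
  if r is r'.+1 then
    (1 - V l) * cost r' k.+1 l.+1 + V l * (d k + cost r' k.+1 0)
  else 0.

Lemma costE r k l : cost r k l = \sum_(j < r) d (k + j)%N * visit l j.+1.
Proof.
elim: r k l => [|r IH] k l; first by rewrite big_ord0.
rewrite big_ord_recl /= !IH addn0 mulr0 add0r mulr1 mulrDr addrCA.
congr (_ + _); first by rewrite mulrC.
rewrite !mulr_sumr -big_split /=; apply: eq_bigr => j _.
by rewrite addSnnS; ring.
Qed.

Hypothesis d_ge0 : forall k, 0 <= d k.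

Hypothesis V_decr : forall l, V l.+1 <= V l.

(** A greater height falls with smaller probability ([h1]), a fall being at least as costly as a
    climb ([h0]); after a climb the induction hypothesis compares the heights ([h2]). *)
Lemma cost_decr r k l : cost r k l.+1 <= cost r k l.
Proof.
elim: r k l => [|r IH] k l //=.
have h0 : 0 <= d k + cost r k.+1 0 - cost r k.+1 l.+2.
  rewrite subr_ge0 (@le_trans _ _ (cost r k.+1 0))//; last by rewrite lerDr.
  by elim: l.+2 => // m; exact: le_trans (IH _ _).
have h1 : 0 <= (V l - V l.+1) * (d k + cost r k.+1 0 - cost r k.+1 l.+2).
  by rewrite mulr_ge0// subr_ge0.
have /andP[V0 V1] := V01 l.
have h2 : 0 <= (1 - V l) * (cost r k.+1 l.+1 - cost r k.+1 l.+2).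
  by rewrite mulr_ge0// subr_ge0.
by rewrite -subr_ge0; move: (addr_ge0 h1 h2); congr (0 <= _); ring.
Qed.

Lemma cost_le0 r k l : cost r k l <= cost r k 0.
Proof. by elim: l => // l; exact: le_trans (cost_decr _ _ _). Qed.

(** Changing the symbol at time k costs [d k] at once and leaves two pasts whose latest symbols
    differ, hence height 0 for the r remaining times. *)
Definition osc (r k : nat) : R := d k + cost r k.+1 0.

Lemma oscE r k : osc r k = \sum_(j < r.+1) d (k + j)%N * visit 0 j.
Proof.
rewrite /osc costE big_ord_recl /= addn0 mulr1; congr (_ + _).
by apply: eq_bigr => j _; rewrite addSnnS.
Qed.

(* Young's inequality for the convolution of d with visit 0. *)
Lemma sum_osc_sqr_le (n : nat) (C : R) :
  (forall N, \sum_(j < N) visit 0 j <= C) ->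
  \sum_(k < n.+1) osc (n - k) k ^+ 2 <= C ^+ 2 * \sum_(k < n.+1) d k ^+ 2.
Proof.
move=> hC; have C0 : 0 < C.
  by apply: lt_le_trans (hC 1%N); rewrite big_ord1.
(* The squares are extended by zero beyond n, so that every shifted sum of [D] is at most the full
   one. *)
pose D m := if (m <= n)%N then d m ^+ 2 else 0.
have D0 m : 0 <= D m by rewrite /D; case: ifP => // _; rewrite sqr_ge0.
have step (k : 'I_n.+1) :
    osc (n - k) k ^+ 2 <= C * \sum_(j < n.+1) visit 0 j * D (k + j)%N.
  have := @sum_weighted_sqr_le _ (fun j : 'I_(n - k).+1 => visit 0 j)
    (fun j => d (k + j)%N) C (fun j => visit_ge0 0 j) C0 (hC _).
  rewrite oscE => /le_trans; apply.
  rewrite ler_pM2l//.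
  have nk : ((n - k).+1 <= n.+1)%N by rewrite ltnS leq_subr.
  rewrite (big_ord_widen _ (fun j => visit 0 j * d (k + j)%N ^+ 2) nk) /=.
  rewrite [leRHS](bigID (fun j : 'I_n.+1 => (j < (n - k).+1)%N)) /=.
  rewrite -[leLHS]addr0; apply: lerD; last first.
    by apply: sumr_ge0 => j _; rewrite mulr_ge0// visit_ge0.
  apply: ler_sum => j jnk; rewrite /D ifT//.
  by move: jnk; rewrite ltnS leq_subRL// -ltnS.
apply: le_trans (ler_sum _ (fun k _ => step k)) _.
rewrite -mulr_sumr expr2 -mulrA ler_pM2l// exchange_big /=.
have DE : \sum_(k < n.+1) d k ^+ 2 = \sum_(0 <= k < n.+1) D k.
  by rewrite big_mkord; apply: eq_bigr => k _; rewrite /D -ltnS ltn_ord.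
rewrite DE; apply: (@le_trans _ _
    (\sum_(j < n.+1) visit 0 j * \sum_(0 <= k < n.+1) D k)); last first.
  by rewrite -mulr_suml ler_wpM2r// sumr_ge0.
apply: ler_sum => j _; rewrite -mulr_sumr ler_wpM2l ?visit_ge0//.
rewrite -(big_mkord xpredT (fun k => D (k + j)%N)).
move: (nat_of_ord j) (ltn_ord j) => {}j jn.
rewrite -{1}(addnK j n.+1) -(big_addn 0 _ j xpredT D).
rewrite add0n (big_cat_nat (n := n.+1)) ?leq_addr//=; last exact: ltnW.
rewrite [X in _ + X]big_nat_cond [X in _ + X]big1 ?addr0; last first.
  by move=> m /andP[/andP[nm _] _]; rewrite /D leqNgt nm.
by rewrite [leRHS](big_cat_nat (n := j)) ?lerDr ?sumr_ge0// ltnW.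
Qed.

End Weighted.
End HouseOfCards.
(** * Hoeffding's lemma *)

Section HoeffdingLemma.
Context {R : realType}.

Lemma is_derive_ge0_le (F dF : R -> R) (b : R) :
  (forall x : R, is_derive x 1 F (dF x)) -> (forall x, 0 <= x -> 0 <= dF x) ->
  0 <= b -> F 0 <= F b.
Proof.
move=> FdF dF0 b0; have der (x : R) : derivable F x 1 by case: (FdF x).
apply: (@ger0_derive1_le_cc _ F 0 b) => //; last 2 first.
- by rewrite in_itv/= lexx b0.
- by rewrite in_itv/= lexx b0.
- move=> x /[!in_itv]/= /andP[/ltW x0 _].
  by rewrite derive1E (@derive_val _ _ _ _ _ _ _ (FdF x)) dF0.
by apply: derivable_within_continuous.
Qed.

(* With q h := p e^h / (1 - p + p e^h), the difference of the logarithms of the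
   two sides has derivative p + h / 4 - q h and second derivative
   1 / 4 - q h (1 - q h) >= 0. *)
Lemma bernoulli_mgf_le (p h : R) : 0 <= p <= 1 ->
  1 - p + p * expR h <= expR (p * h + h ^+ 2 / 8).
Proof.
(* Multiplying by [expR (- h)] exchanges (p, h) with (1 - p, - h). *)
wlog h0 : p h / 0 <= h => [wl /andP[p0 p1]|].
  have [/wl|/ltW h0] := leP 0 h; first by apply; rewrite p0.
  have := wl (1 - p) (- h); rewrite oppr_ge0 => /(_ h0).
  have -> : 0 <= 1 - p <= 1 by lra.
  move=> /(_ isT) le; rewrite -(ler_pM2l (expR_gt0 (- h))) -expRD.
  apply: le_trans (le_trans le _); rewrite ?ler_expR.
    rewrite mulrDr mulrCA -expRD addNr expR0 le_eqVlt.
    by apply/orP; left; apply/eqP; ring.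
  by rewrite le_eqVlt; apply/orP; left; apply/eqP; field.
move=> /andP[p0 p1].
pose D x := 1 - p + p * expR x.
have D0 x : 0 < D x.
  rewrite /D; have [->|p_neq0] := eqVneq p 0.
    by rewrite mul0r addr0 subr0.
  by rewrite ltr_wpDl ?subr_ge0// mulr_gt0 ?expR_gt0// lt_neqAle eq_sym p_neq0.
have dD (x : R) : is_derive x 1 D (p * expR x).
  rewrite /D; by apply: is_derive_eq; rewrite add0r mul1r.
pose q x := p * expR x / D x.
have dq (x : R) : is_derive x 1 q (q x * (1 - q x)).
  have dV := @is_deriveV _ D x _ 1 (lt0r_neq0 (D0 x)) (dD x).
  rewrite /q; apply: is_derive_eq.
  rewrite /GRing.scale/=; move: (D x) (lt0r_neq0 (D0 x)) => y y0.
  by field.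
pose F1 x := p + x / 4 - q x.
have dF1 (x : R) : is_derive x 1 F1 (4^-1 - q x * (1 - q x)).
  by rewrite /F1; apply: is_derive_eq; rewrite /GRing.scale/=; field.
have F1_ge0 x : 0 <= x -> 0 <= F1 x.
  move=> x0; have F10 : F1 0 = 0.
    by rewrite /F1 /q /D expR0 mulr1 subrK divr1 mul0r addr0 subrr.
  have := is_derive_ge0_le dF1 _ x0; rewrite F10; apply => y _ /=.
  by have := sqr_ge0 (q y - 2^-1); nra.
pose F x := p * x + x ^+ 2 / 8 - ln (D x).
have dF (x : R) : is_derive x 1 F (F1 x).
  have dln := @is_derive1_comp _ (@ln R) D x _ _ (is_derive1_ln (D0 x)) (dD x).
  rewrite /F; apply: is_derive_eq; rewrite /GRing.scale/= /F1 /q.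
  by move: (D x) (lt0r_neq0 (D0 x)) => y y0; field.
have := is_derive_ge0_le dF F1_ge0 h0.
have -> : F 0 = 0.
  by rewrite /F /D expR0 mulr0 expr0n/= mul0r mulr1 subrK ln1; ring.
by rewrite /F subr_ge0 -ler_expR lnK// posrE.
Qed.

Context d (T : measurableType d) (P : probability T R).

Lemma bounded_integrable (X : T -> R) (a b : R) :
  measurable_fun setT X -> (forall w, a <= X w <= b) ->
  P.-integrable setT (EFin \o X).
Proof.
move=> mX Xab; apply: measurable_bounded_integrable => //.
  by rewrite (le_lt_trans (probability_le1 _ _))// ltry.
exists (`|a| + `|b|); split; first by rewrite num_real.
move=> x Mx y _; apply: le_trans (ltW Mx); have /andP[aX Xb] := Xab y.
have aa := ler_norm (- a); rewrite normrN in aa.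
have := (ler_norm b, normr_ge0 a, normr_ge0 b) => -[[bb a0] b0].
by rewrite ler_norml; apply/andP; split; lra.
Qed.

Lemma Rintegral_prob_cst (c : R) : \int[P]_w c = c.
Proof.
rewrite Rintegral_cst//; transitivity (c * fine (1 : \bar R)%E).
  by congr (_ * fine _); exact: probability_setT.
by rewrite mulr1.
Qed.

Lemma Rintegral_affine (X : T -> R) (a b c e : R) :
  measurable_fun setT X -> (forall w, a <= X w <= b) ->
  \int[P]_w (c + e * X w) = c + e * \int[P]_w X w.
Proof.
move=> mX Xab; have iX := bounded_integrable mX Xab.
have ic : P.-integrable setT (EFin \o (fun=> c)).
  by apply: (@bounded_integrable _ c c) => // w; rewrite lexx.
have ieX : P.-integrable setT (EFin \o (fun w => e * X w)).
  exact: (integrableZl _ e iX).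
by rewrite RintegralD// RintegralZl// Rintegral_prob_cst.
Qed.

Lemma Rintegral_itv (X : T -> R) (a b : R) :
  measurable_fun setT X -> (forall w, a <= X w <= b) ->
  a <= \int[P]_w X w <= b.
Proof.
move=> mX Xab; have iX := bounded_integrable mX Xab.
have ic c : P.-integrable setT (EFin \o (fun=> c)).
  by apply: (@bounded_integrable _ c c) => // w; rewrite lexx.
apply/andP; split.
- rewrite -[leLHS]Rintegral_prob_cst; apply: le_Rintegral => // w _.
  by case/andP: (Xab w).
- rewrite -[leRHS]Rintegral_prob_cst; apply: le_Rintegral => // w _.
  by case/andP: (Xab w).
Qed.

(** Weight the tangent at x, evaluated at b and at a, by x - a and b - x: the slope terms cancel. *)
Lemma expR_chord (a b t x : R) : a <= x <= b ->
  (b - a) * expR (t * x) <=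
  (b * expR (t * a) - a * expR (t * b)) + (expR (t * b) - expR (t * a)) * x.
Proof.
move=> /andP[ax xb].
have tangent z : expR (t * x) * (1 + t * (z - x)) <= expR (t * z).
  rewrite -[in leRHS](subrKC x z) [in leRHS]mulrDr expRD ler_pM2l ?expR_gt0//.
  exact: expR_ge1Dx.
have h1 : (x - a) * (expR (t * x) * (1 + t * (b - x))) <=
    (x - a) * expR (t * b).
  by rewrite ler_wpM2l// subr_ge0.
have h2 : (b - x) * (expR (t * x) * (1 + t * (a - x))) <=
    (b - x) * expR (t * a).
  by rewrite ler_wpM2l// subr_ge0.
have := lerD h1 h2; rewrite -subr_ge0 => h; rewrite -subr_ge0.
by move: h; congr (0 <= _); ring.
Qed.

Lemma expR_scale_itv (a b t x : R) : a <= x <= b ->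
  0 <= expR (t * x) <= expR (Num.max (t * a) (t * b)).
Proof.
move=> /andP[ax xb]; rewrite expR_ge0/= ler_expR le_max.
have [t0|/ltW t0] := leP 0 t; first by rewrite (ler_wpM2l t0 xb) orbT.
by rewrite (ler_wnM2l t0 ax).
Qed.

(** The chord replaces the law of X by the law on {a, b} with the same mean, which gives b the mass
    [p]; [bernoulli_mgf_le] then applies with h = t (b - a). *)
Lemma hoeffding_lemma (X : T -> R) (a b t : R) :
  measurable_fun setT X -> (forall w, a <= X w <= b) ->
  \int[P]_w expR (t * X w) <=
  expR (t * \int[P]_w X w + t ^+ 2 * (b - a) ^+ 2 / 8).
Proof.
move=> mX Xab; have /andP[aE Eb] := Rintegral_itv mX Xab.
set m := \int[P]_w X w in aE Eb *.
have mtX : measurable_fun setT (fun w => expR (t * X w)).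
  by apply: measurableT_comp => //; exact: measurable_funM.
(* The chord has no slope when a = b, but X is then constant. *)
have [ab|ab] := eqVneq a b.
  have -> : m = a by apply/le_anti; rewrite aE ab Eb.
  have XE w : X w = a.
    by apply/le_anti; rewrite andbC; have := Xab w; rewrite -ab.
  have /andP[_] : expR (t * a) <= \int[P]_w expR (t * X w) <= expR (t * a).
    by apply: Rintegral_itv => // w; rewrite XE lexx.
  by rewrite -ab subrr expr0n/= mulr0 mul0r addr0.
have ltab : 0 < b - a by rewrite subr_gt0 lt_neqAle ab (le_trans aE).
pose c := (b * expR (t * a) - a * expR (t * b)) / (b - a).
pose e := (expR (t * b) - expR (t * a)) / (b - a).
have chord w : expR (t * X w) <= c + e * X w.
  rewrite -(ler_pM2l ltab) (le_trans (expR_chord t (Xab w)))//.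
  rewrite le_eqVlt; apply/orP; left; apply/eqP; rewrite /c /e.
  by field; exact: lt0r_neq0.
apply: (@le_trans _ _ (c + e * m)).
  rewrite /m -(Rintegral_affine _ _ mX Xab); apply: le_Rintegral => //.
    apply: (@bounded_integrable _ 0 (expR (Num.max (t * a) (t * b)))) => // w.
    exact: expR_scale_itv.
  have ic : P.-integrable setT (EFin \o (fun=> c)).
    by apply: (@bounded_integrable _ c c) => // w; rewrite lexx.
  have ieX := integrableZl measurableT e (bounded_integrable mX Xab).
  exact: (integrableD measurableT ic ieX).
pose p := (m - a) / (b - a).
have -> : c + e * m = expR (t * a) * (1 - p + p * expR (t * (b - a))).
  rewrite mulrDr [X in _ = _ + X]mulrCA -expRD -mulrDr subrKC /c /e /p.
  by field; exact: lt0r_neq0.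
have p01 : 0 <= p <= 1.
  apply/andP; split; first by rewrite divr_ge0// ?(ltW ltab)// subr_ge0.
  by rewrite ler_pdivrMr// mul1r lerD2r.
rewrite (le_trans (ler_wpM2l (expR_ge0 _) (bernoulli_mgf_le _ p01)))//.
rewrite -expRD ler_expR le_eqVlt; apply/orP; left; apply/eqP.
by rewrite /p; field; rewrite gt_eqF.
Qed.
End HoeffdingLemma.
(** * Countable sums and trajectories *)

Section CountableSums.
Context {R : realType}.

Lemma esumZ (T : choiceType) (r : R) (F : T -> \bar R) : 0 <= r ->
  (forall i, 0 <= F i)%E ->
  (\esum_(i in [set: T]) (r%:E * F i) = r%:E * \esum_(i in [set: T]) F i)%E.
Proof.
move=> r0 F0; rewrite /esum -ereal_supZl//; last first.
  by apply/set0P; exists 0%E; exists set0;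
    rewrite ?fsbig_set0//; exact: fsets_set0.
congr ereal_sup; apply/seteqP; split => [_ [X [finX XT] <-]|].
  by exists (\sum_(x \in X) F x)%E; [exists X|rewrite ge0_mule_fsumr].
move=> _ [_ [X [finX XT] <-] <-]; exists X => //.
by rewrite ge0_mule_fsumr.
Qed.

(** An injection [rk] of the index set into nat turns the union into a sequence of sets, empty
    outside the range of [rk]. *)
Lemma ge0_integral_bigcup_esum d (T : measurableType d)
    (mu : {measure set T -> \bar R}) (I : choiceType) (D : I -> set T)
    (phi : T -> \bar R) :
  countable [set: I] -> (forall i, measurable (D i)) -> trivIset setT D ->
  measurable_fun (\bigcup_i D i) phi ->
  (forall w, (\bigcup_i D i) w -> 0 <= phi w)%E ->
  (\int[mu]_(w in \bigcup_i D i) phi w =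
   \esum_(i in [set: I]) \int[mu]_(w in D i) phi w)%E.
Proof.
move=> /countable_injP[rk rk_inj] mD tD mphi phi0.
pose F k := \bigcup_(i in rk @^-1` [set k]) D i.
have rkI i j : rk i = rk j -> i = j by apply: rk_inj; rewrite inE.
have FD i : F (rk i) = D i.
  apply/seteqP; split => [w [j /= /rkI -> //]|w Diw].
  by exists i.
have F0 k : ~ range rk k -> F k = set0.
  by move=> nk; rewrite -subset0 => w [i /= rki _]; apply: nk; exists i.
have FE k : (exists i, F k = D i) \/ F k = set0.
  have [[i _ <-]|] := pselect (range rk k); last by move/F0; right.
  by left; exists i; rewrite FD.
have mF k : measurable (F k).
  by case: (FE k) => [[i ->]//|->]; exact: measurable0.
have UF : \bigcup_i D i = \bigcup_k F k.
  apply/seteqP; split => [w [i _ Diw]|w [k _ [i _ Diw]]]; last by exists i.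
  by exists (rk i) => //; rewrite FD.
rewrite UF ge0_integral_bigcup//; last 3 first.
- by rewrite -UF.
- by rewrite -UF.
- move=> k l _ _ [w [[i /= <- Diw] [j /= <- Djw]]].
  by congr rk; apply: tD => //; exists w.
rewrite nneseries_esumT; last first.
  by move=> k; apply: integral_ge0 => w Fw; apply: phi0; rewrite UF; exists k.
under [RHS]eq_esum do rewrite -FD.
rewrite -(esum_image setT rk (fun k => \int[mu]_(w in F k) phi w)%E)//.
rewrite [RHS]esum_mkcond; apply: eq_esum => k _; case: ifPn => // /negP.
by rewrite inE => /F0 ->; rewrite integral_set0.
Qed.

End CountableSums.

(** * Cylinders and dependence on finitely many coordinates *)

Section Trajectories.
Context {A : pointedType}.

Definition upd (w : nat -> A) (k : nat) (a : A) : nat -> A :=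
  fun i => if i == k then a else w i.

Definition push (z : past A) (a : A) : past A :=
  fun k => if k is k'.+1 then z k' else a.

(* cyl w k fixes the first k coordinates, so that cyl w 0 is the whole space. *)
Definition cyl (w : nat -> A) (k : nat) : set (trajectory A) :=
  [set w' | forall i, (i < k)%N -> w' i = w i].

Definition prefix_dep (T : Type) (m : nat) (phi : (nat -> A) -> T) :=
  forall w w', (forall i, (i < m)%N -> w i = w' i) -> phi w = phi w'.

Lemma upd_same w k a : upd w k a k = a.
Proof. by rewrite /upd eqxx. Qed.

Lemma upd_lt w k a i : (i < k)%N -> upd w k a i = w i.
Proof. by rewrite /upd => /ltn_eqF ->. Qed.

Lemma updC w i j a b : i != j -> upd (upd w i a) j b = upd (upd w j b) i a.
Proof.
move=> ij; apply/funext => m; rewrite /upd.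
by case: (eqVneq m j) => [->|//]; rewrite eq_sym (negbTE ij).
Qed.

Lemma concat0 (x : past A) w : concat x w 0 = x.
Proof. by apply/funext => k; rewrite /concat/= subn0. Qed.

Lemma eq_concat (x : past A) w w' k : (forall i, (i < k)%N -> w i = w' i) ->
  concat x w k = concat x w' k.
Proof.
move=> ww'; apply/funext => i; rewrite /concat; case: ifPn => // ik.
by rewrite ww'// ltn_subrL (leq_ltn_trans _ ik).
Qed.

Lemma concat_upd (x : past A) w k a :
  concat x (upd w k a) k.+1 = push (concat x w k) a.
Proof.
apply/funext => -[|i]; rewrite /concat /push; first by rewrite subn1 upd_same.
rewrite ltnS subSS; case: ifPn => // ik.
by rewrite upd_lt// ltn_subrL (leq_ltn_trans _ ik).
Qed.

Lemma cyl0 w : cyl w 0 = setT.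
Proof. by apply/seteqP; split. Qed.

Lemma measurable_cyl w k : measurable (cyl w k).
Proof.
case: k => [|k]; first by rewrite cyl0; exact: measurableT.
by apply: sub_sigma_algebra; exists w, k.
Qed.

Lemma cyl_bigcup w k : cyl w k = \bigcup_a cyl (upd w k a) k.+1.
Proof.
apply/seteqP; split => [v wv|v [a _ wv] i ik].
  exists (v k) => // i; rewrite ltnS leq_eqVlt => /predU1P[->|ik].
    by rewrite upd_same.
  by rewrite upd_lt// wv.
by rewrite wv ?upd_lt// ltnS ltnW.
Qed.

Lemma trivIset_cyl w k : trivIset setT (fun a => cyl (upd w k a) k.+1).
Proof.
move=> a b _ _ [v [va vb]].
by rewrite -(upd_same w k a) -(upd_same w k b) -va// -vb.
Qed.

Hypothesis cA : countable [set: A].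

(** Induction on the number r of coordinates still free: with none, a cylinder lies inside S or
    misses it; otherwise it is a countable union over the next symbol. *)
Lemma measurable_prefix (S : set (trajectory A)) (m : nat) :
  prefix_dep m S -> measurable S.
Proof.
move=> Sm; suff main r k w : m = (k + r)%N -> measurable (S `&` cyl w k).
  by rewrite -(setIT S) -(cyl0 (fun=> point)); exact: (main m 0%N).
elim: r k w => [|r IH] k w; last first.
  rewrite addnS -addSn cyl_bigcup setI_bigcupr => mkr.
  by apply: countable_bigcupT_measurable => // a; exact: IH.
rewrite addn0 => mk.
have [Sw|Sw] := pselect (S w).
  rewrite (_ : _ `&` _ = cyl w k); first exact: measurable_cyl.
  apply/seteqP; split => [v []//|v vw]; split => //.
  by rewrite (Sm v w)// mk.
rewrite (_ : _ `&` _ = set0); first exact: measurable0.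
apply/seteqP; split => [v [Sv vw]|v []]//; apply: Sw.
by rewrite -(Sm v w)// mk.
Qed.

Lemma measurable_prefix_fun d (T : measurableType d) (m : nat)
    (phi : trajectory A -> T) :
  prefix_dep m phi -> measurable_fun setT phi.
Proof.
move=> phim _ Y mY; rewrite setTI; apply: (@measurable_prefix _ m) => w w' ww'.
by rewrite /preimage/= (phim w w').
Qed.

End Trajectories.
(** * Variation of the kernel *)

Section Variation.
Context {R : realType} {A : pointedType} (g : A -> past A -> R).
Hypothesis g_kernel : is_kernel g.

Lemma tv_itv (z z' : past A) : (0 <= tv (g^~ z) (g^~ z') <= 1)%E.
Proof.
have [g01 g1] := g_kernel; have g0 a x : 0 <= g a x by case/andP: (g01 a x).
apply/andP; split.
  by rewrite mule_ge0 ?lee_fin ?invr_ge0// esum_ge0.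
have : (\esum_(a in [set: A]) `|g a z - g a z'|%:E <= 2%:E)%E.
  rewrite (_ : 2%:E = 1 + 1)%E; last by rewrite -EFinD.
  rewrite -{1}(g1 z) -(g1 z') -esumD//; try by move=> i _; rewrite lee_fin.
  apply: le_esum => a _; rewrite -EFinD lee_fin.
  by rewrite (le_trans (ler_normB _ _))// !ger0_norm.
rewrite /tv => h; apply: (@le_trans _ _ ((2^-1)%:E * 2%:E)%E).
  by rewrite lee_wpmul2l// lee_fin invr_ge0.
by rewrite -EFinM mulVf.
Qed.

(** The supremum lies in [0, 1], so [fine] loses nothing. *)
Lemma VarE l : (Var g l)%:E = ereal_sup [set r | exists z z' : past A,
  (forall k, (k < l)%N -> z k = z' k) /\ r = tv (g^~ z) (g^~ z')].
Proof.
rewrite /Var fineK// ge0_fin_numE; last first.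
  apply: (@le_trans _ _ (tv (g^~ (fun=> point)) (g^~ (fun=> point)))).
    by case/andP: (tv_itv (fun=> point) (fun=> point)).
  by apply: ereal_sup_ubound; exists (fun=> point), (fun=> point).
apply: (@le_lt_trans _ _ 1%E); last exact: ltry.
by apply: ge_ereal_sup => _ [z [z' [_ ->]]]; case/andP: (tv_itv z z').
Qed.

Lemma tv_le_Var l (z z' : past A) : (forall k, (k < l)%N -> z k = z' k) ->
  (tv (g^~ z) (g^~ z') <= (Var g l)%:E)%E.
Proof. by move=> zz'; rewrite VarE; apply: ereal_sup_ubound; exists z, z'. Qed.

Lemma Var_itv l : 0 <= Var g l <= 1.
Proof.
rewrite -!lee_fin; apply/andP; split.
  have /andP[tv0 _] := tv_itv (fun=> point) (fun=> point).
  by apply: le_trans tv0 _; exact: tv_le_Var.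
rewrite VarE; apply: ge_ereal_sup => _ [z [z' [_ ->]]].
by case/andP: (tv_itv z z').
Qed.

Lemma Var_decr l : Var g l.+1 <= Var g l.
Proof.
rewrite -lee_fin VarE; apply: ge_ereal_sup => _ [z [z' [zz' ->]]].
by apply: tv_le_Var => k kl; apply: zz'; exact: ltnW.
Qed.

Lemma Gamma_le_prod n : Gamma g <= \prod_(0 <= j < n) (1 - Var g j).
Proof.
have V1 j : 0 <= 1 - Var g j by rewrite subr_ge0; case/andP: (Var_itv j).
have decr : nonincreasing_seq (fun n => \prod_(0 <= j < n) (1 - Var g j)).
  apply/nonincreasing_seqP => m; rewrite big_nat_recr//= ler_piMr//.
    by apply: prodr_ge0 => j _.
  by rewrite lerBlDr lerDl; case/andP: (Var_itv m).
apply: nonincreasing_cvgn_ge => //; apply: nonincreasing_is_cvgn => //.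
by exists 0 => _ [m _ <-]; apply: prodr_ge0.
Qed.

Lemma sum_visit_le_Gamma N : 0 < Gamma g ->
  \sum_(j < N) visit (Var g) 0 j <= (Gamma g)^-1.
Proof.
move=> G0; have prod0 m : 0 < \prod_(0 <= j < m) (1 - Var g j).
  exact: lt_le_trans (Gamma_le_prod m).
(* The tail product of the [1 - Var g j] over j >= m: the probability that the chain never falls
   from height m. *)
pose G m := Gamma g / \prod_(0 <= j < m) (1 - Var g j).
have G00 : G 0%N = Gamma g by rewrite /G big_nil divr1.
have := @sum_visit_le _ _ Var_itv G N 0%N; rewrite G00 eqxx => H.
apply: le_trans (H _ _ _) _ => //.
- by move=> m; rewrite ler_pdivrMr// mul1r Gamma_le_prod.
- move=> m; rewrite /G big_nat_recr//=.
  have : 1 - Var g m != 0.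
    apply: contraTneq (prod0 m.+1) => V0.
    by rewrite big_nat_recr//= V0 mulr0 ltxx.
  move: (\prod_(0 <= j < m) _) (lt0r_neq0 (prod0 m)) => q q0 V0.
  by move: (1 - Var g m) V0 => v v0; field; rewrite q0 v0.
- rewrite le_eqVlt; apply/orP; left; apply/eqP; rewrite /=.
  by field; exact: lt0r_neq0.
Qed.

End Variation.
(** * Iterated means *)

Section Specified.
Context {R : realType} {A : pointedType}.
Hypothesis A_countable : countable [set: A].
Variable g : A -> past A -> R.
Hypothesis g_kernel : is_kernel g.
Variable P : past A -> probability (trajectory A) R.
Hypothesis P_spec : forall x, specified_by g x (P x).

Lemma g_ge0 a z : 0 <= g a z.
Proof. by have [g01 _] := g_kernel; case/andP: (g01 a z). Qed.

Lemma P_cyl x w k :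
  P x (cyl w k) = (\prod_(j < k) g (w j) (concat x w j))%:E.
Proof.
case: k => [|k]; last exact: P_spec.
by rewrite cyl0 big_ord0; exact: probability_setT.
Qed.

Lemma P_cyl_upd x w k a :
  (P x (cyl (upd w k a) k.+1) = (g a (concat x w k))%:E * P x (cyl w k))%E.
Proof.
rewrite !P_cyl big_ord_recr/= -EFinM mulrC upd_same; congr (_ * _)%:E.
  by congr g; apply: eq_concat => i ik; rewrite upd_lt.
apply: eq_bigr => j _; rewrite upd_lt//; congr g.
by apply: eq_concat => i ij; rewrite upd_lt// (ltn_trans ij).
Qed.

(* Under P z, the first coordinate has law g(. | z). *)
Definition mean (z : past A) (H : A -> R) : R := \int[P z]_w H (w 0%N).

Lemma measurable_coord0 (H : A -> R) :
  measurable_fun setT (fun w : trajectory A => H (w 0%N)).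
Proof.
apply: (measurable_prefix_fun A_countable (m := 1%N)) => w w' ww'.
by rewrite ww'.
Qed.

Lemma mean_affine z H (a b c e : R) : (forall i, a <= H i <= b) ->
  mean z (fun i => c + e * H i) = c + e * mean z H.
Proof.
move=> Hab; apply: (@Rintegral_affine _ _ _ (P z) (fun w => H (w 0%N)) a b).
  exact: measurable_coord0.
by move=> w; exact: Hab.
Qed.

Lemma mean_itv z H (a b : R) : (forall i, a <= H i <= b) -> a <= mean z H <= b.
Proof.
move=> Hab; apply: Rintegral_itv; first exact: measurable_coord0.
by move=> w; exact: Hab.
Qed.

Lemma le_mean z H H' (a b a' b' : R) :
  (forall i, a <= H i <= b) -> (forall i, a' <= H' i <= b') ->
  (forall i, H i <= H' i) -> mean z H <= mean z H'.
Proof.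
move=> Hab Hab' HH'; apply: le_Rintegral => //.
- apply: (@bounded_integrable _ _ _ _ _ a b); first exact: measurable_coord0.
  by move=> w; exact: Hab.
- apply: (@bounded_integrable _ _ _ _ _ a' b'); first exact: measurable_coord0.
  by move=> w; exact: Hab'.
Qed.

Lemma mean_hoeffding z H (a b t : R) : (forall i, a <= H i <= b) ->
  mean z (fun i => expR (t * H i)) <=
  expR (t * mean z H + t ^+ 2 * (b - a) ^+ 2 / 8).
Proof.
move=> Hab; apply: hoeffding_lemma; first exact: measurable_coord0.
by move=> w; exact: Hab.
Qed.

(** Split the space by the first symbol: each cylinder of length one has mass [g i z], and the
    integrand is constant on it. *)
Lemma mean_esum z H (b : R) : (forall i, 0 <= H i <= b) ->
  (mean z H)%:E = \esum_(i in [set: A]) (g i z * H i)%:E.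
Proof.
move=> Hb; have H0 i : 0 <= H i by case/andP: (Hb i).
have intH :
    (P z).-integrable setT (EFin \o (fun w : trajectory A => H (w 0%N))).
  apply: (@bounded_integrable _ _ _ _ _ 0 b); first exact: measurable_coord0.
  by move=> w; exact: Hb.
rewrite /mean /Rintegral fineK; last exact: integrable_fin_num.
rewrite -(cyl0 (fun=> point)) cyl_bigcup.
rewrite (ge0_integral_bigcup_esum (P z) A_countable); first last.
- by move=> w _; rewrite lee_fin.
- rewrite -cyl_bigcup; apply/measurable_funTS/measurable_EFinP.
  exact: measurable_coord0.
- exact: trivIset_cyl.
- by move=> a; exact: measurable_cyl.
apply: eq_esum => a _.
transitivity
  (\int[P z]_(w in cyl (upd (fun=> point) 0 a) 1) (cst (H a)%:E) w)%E.
  apply: eq_integral => w; rewrite inE => /(_ 0%N isT) ->.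
  by rewrite upd_same.
rewrite integral_cst; last exact: measurable_cyl.
transitivity ((H a)%:E * P z (cyl (upd (fun=> point) 0 a) 1))%E => //.
by rewrite P_cyl_upd cyl0 concat0 probability_setT mule1 -EFinM mulrC.
Qed.

(** Duality of total variation and oscillation. Adding D to the difference makes it the mean of K -
    c under z plus that of D + c - K under z', two sums of nonnegative terms. *)
Lemma mean_sub_le l z z' K (c D : R) :
  (forall k, (k < l)%N -> z k = z' k) -> (forall i, c <= K i <= c + D) ->
  mean z K - mean z' K <= Var g l * D.
Proof.
move=> zz' KcD.
have D0 : 0 <= D by have /andP[/le_trans h /h] := KcD point; rewrite lerDl.
have K1 i : 0 <= - c + 1 * K i <= D.
  by have := KcD i; lra.
have K2 i : 0 <= (D + c) + (-1) * K i <= D.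
  by have := KcD i; lra.
have e1 := mean_esum z K1; have e2 := mean_esum z' K2.
rewrite (mean_affine _ _ _ KcD) in e1; rewrite (mean_affine _ _ _ KcD) in e2.
have := tv_le_Var g_kernel zz'; rewrite /tv.
have [_ g1] := g_kernel.
set S := (\esum_(a in [set: A]) `|g a z - g a z'|%:E)%E => hS.
have S0 : (0 <= S)%E by apply: esum_ge0 => i _; rewrite lee_fin.
have : (((- c + 1 * mean z K) + (D + c + (-1) * mean z' K))%:E <=
    D%:E + (D * Var g l)%:E)%E.
  rewrite EFinD e1 e2 -esumD; first last.
  - by move=> i _; rewrite lee_fin mulr_ge0 ?g_ge0//; case/andP: (K2 i).
  - by move=> i _; rewrite lee_fin mulr_ge0 ?g_ge0//; case/andP: (K1 i).
  (* Termwise, p u + q (D - u) <= (D / 2) (p + q + |p - q|), with p and q the two transition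
     probabilities; the gap is half of [h1] plus [h2]. *)
  apply: (@le_trans _ _ (\esum_(i in [set: A])
      ((D / 2)%:E * ((g i z)%:E + (g i z')%:E + `|g i z - g i z'|%:E)))%E).
    apply: le_esum => i _; rewrite -!EFinD -EFinM lee_fin.
    set s := `|g i z - g i z'|; set u := - c + 1 * K i in K1 *.
    have h1 : 0 <= (s - (g i z - g i z')) * u.
      by rewrite mulr_ge0 ?subr_ge0 ?ler_norm//; case/andP: (K1 i).
    have h2 : 0 <= (s + (g i z - g i z')) * (D - u).
      rewrite mulr_ge0 ?subr_ge0//; last by case/andP: (K1 i).
      by rewrite -(opprK (_ - _)) subr_ge0 /s -normrN ler_norm.
    rewrite -subr_ge0; have := divr_ge0 (addr_ge0 h1 h2) (ler0n _ 2).
    by congr (0 <= _); rewrite /u; field.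
  rewrite esumZ; last 2 first.
  - by rewrite divr_ge0.
  - by move=> i; rewrite -!EFinD lee_fin !addr_ge0 ?g_ge0.
  rewrite esumD; last 2 first.
  - by move=> i _; rewrite -EFinD lee_fin !addr_ge0 ?g_ge0.
  - by move=> i _; rewrite lee_fin.
  rewrite esumD; last 2 first.
  - by move=> i _; rewrite lee_fin g_ge0.
  - by move=> i _; rewrite lee_fin g_ge0.
  rewrite !g1 -/S; case: S hS S0 => [s||]//; last first.
    by rewrite gt0_muley ?lte_fin ?invr_gt0.
  rewrite -EFinM !lee_fin => hS s0.
  rewrite -subr_ge0 (_ : _ - _ = D * (Var g l - 2^-1 * s)); last by field.
  by rewrite mulr_ge0// subr_ge0.
by rewrite -EFinD lee_fin; lra.
Qed.

Lemma mean_sub_le_cst z H H' (a b a' b' c : R) :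
  (forall i, a <= H i <= b) -> (forall i, a' <= H' i <= b') ->
  (forall i, H i - H' i <= c) -> mean z H - mean z H' <= c.
Proof.
move=> Hab Hab' Hc; rewrite lerBlDr -[X in _ + X]mul1r.
rewrite -(mean_affine _ _ _ Hab').
apply: (@le_mean _ _ _ a b (c + a') (c + b')) => // i.
  by rewrite mul1r !lerD2l.
by rewrite mul1r -lerBlDr.
Qed.

Lemma inf_rangeP (H : A -> R) (a : R) : (forall i, a <= H i) ->
  exists2 m, (forall i, m <= H i) & (forall x, (forall i, x <= H i) -> x <= m).
Proof.
move=> aH; have [lb_inf inf_max] : (forall i, inf (range H) <= H i) /\
    (forall x, (forall i, x <= H i) -> x <= inf (range H)).
  split=> [i|x xH].
    by apply: ge_inf; [exists a => _ [j _ <-]|exists i].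
  by apply: lb_le_inf; [exists (H point), point|move=> _ [j _ <-]].
by exists (inf (range H)).
Qed.

(** With m the infimum of H, the values of H lie in [m, m + c]. *)
Lemma mean_hoeffding_osc z H (a b c t : R) : (forall i, a <= H i <= b) ->
  (forall i j, H i - H j <= c) ->
  mean z (fun i => expR (t * H i)) <= expR (t * mean z H + t ^+ 2 * c ^+ 2 / 8).
Proof.
move=> Hab Hc; have [|m mH mmax] := @inf_rangeP H a.
  by move=> i; case/andP: (Hab i).
have -> : c = (m + c) - m by rewrite addrAC subrr add0r.
apply: mean_hoeffding => i; rewrite mH -lerBlDr/=.
by apply: mmax => j; have := Hc i j; lra.
Qed.

(* The function max (H - alpha) (inf H') lies between H - alpha and H', and it
   oscillates by at most beta - alpha, so that duality applies to it. *)
Lemma mean_coupling l z z' H H' (a b alpha beta : R) :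
  (forall k, (k < l)%N -> z k = z' k) ->
  (forall i, a <= H i <= b) -> (forall i, a <= H' i <= b) ->
  (forall i, H i - H' i <= alpha) -> (forall i j, H i - H' j <= beta) ->
  alpha <= beta ->
  mean z H - mean z' H' <= (1 - Var g l) * alpha + Var g l * beta.
Proof.
move=> zz' Hab Hab' Ha Hb ab.
have [|m mH' mmax] := @inf_rangeP H' a.
  by move=> i; case/andP: (Hab' i).
pose K i := Num.max (H i - alpha) m.
have Km i : m <= K i <= m + (beta - alpha).
  rewrite /K le_max lexx orbT/= ge_max lerDl subr_ge0 ab andbT.
  have : H i - beta <= m by apply: mmax => j; have := Hb i j; lra.
  by lra.
have HK i : H i - K i <= alpha.
  by rewrite lerBlDr -lerBlDl /K le_max lexx.
have KH' i : K i <= H' i.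
  by rewrite /K ge_max mH' andbT lerBlDr -lerBlDl.
(* Passing through the means of [K] under z and z', the three differences are at most [alpha],
   [Var g l * (beta - alpha)] and 0. *)
have h1 := mean_sub_le_cst z Hab Km HK.
have h2 := le_mean z' Km Hab' KH'.
have h3 := mean_sub_le zz' Km.
by lra.
Qed.

(** * Iterated means and their oscillations *)

Section Expect.
Variable phi : (nat -> A) -> R.

(* The mean of phi over the coordinates k, ..., k + r - 1, generated by g from
   the past z, the other coordinates being those of w. *)
Fixpoint expect (r k : nat) (z : past A) (w : nat -> A) : R :=
  if r is r'.+1 then
    mean z (fun a => expect r' k.+1 (push z a) (upd w k a))
  else phi w.

Variables (a b : R).
Hypothesis phi_itv : forall w, a <= phi w <= b.

Lemma expect_itv r k z w : a <= expect r k z w <= b.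
Proof.
by elim: r k z w => [|r IH] k z w //=; apply: mean_itv => i; exact: IH.
Qed.

Variable d : nat -> R.
Hypothesis d_ge0 : forall k, 0 <= d k.
Hypothesis phi_d : forall w k i j, phi (upd w k i) - phi (upd w k j) <= d k.

Lemma expect_upd r k z w m i j : (m < k)%N ->
  expect r k z (upd w m i) - expect r k z (upd w m j) <= d m.
Proof.
elim: r k z w => [|r IH] k z w mk /=; first exact: phi_d.
apply: (@mean_sub_le_cst _ _ _ a b a b) => c.
- exact: expect_itv.
- exact: expect_itv.
- by rewrite !(@updC _ _ m k) ?ltn_eqF//; apply: IH; exact: ltnW.
Qed.

Let V := Var g.

(** If the next symbols agree, the pasts agree on l + 1 symbols; if not, [d k] is paid and the
    height drops to 0. With these two costs as [alpha] and [beta], [mean_coupling] yields the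
    recursion of [cost]. *)
Lemma expect_cost r k l z z' w :
  (forall i, (i < l)%N -> z i = z' i) ->
  expect r k z w - expect r k z' w <= cost V d r k l.
Proof.
elim: r k l z z' w => [|r IH] k l z z' w zz' /=; first by rewrite subrr.
apply: (mean_coupling (a := a) (b := b)) => //.
- by move=> i; exact: expect_itv.
- by move=> i; exact: expect_itv.
- by move=> i; apply: IH => -[|m] //=; rewrite ltnS => /zz'.
- move=> i j.
  have h1 := @expect_upd r k.+1 (push z i) w k i j (ltnSn k).
  have h2 := IH k.+1 0%N (push z i) (push z' j) (upd w k j).
  have := lerD h1 (h2 _); rewrite addrA subrK; exact.
- have := cost_le0 (Var_itv g_kernel) d_ge0 (Var_decr g_kernel) r k.+1 l.+1.
  move=> /le_trans; apply.
  by rewrite lerDr.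
Qed.

Lemma expect_osc r k z w i j :
  expect r k.+1 (push z i) (upd w k i) - expect r k.+1 (push z j) (upd w k j)
  <= osc V d r k.
Proof.
have h1 := @expect_upd r k.+1 (push z i) w k i j (ltnSn k).
have h2 := @expect_cost r k.+1 0%N (push z i) (push z j) (upd w k j).
by have := lerD h1 (h2 _); rewrite addrA subrK; exact.
Qed.

End Expect.

Lemma expect_affine (phi : (nat -> A) -> R) (a b c e : R) r k z w :
  (forall w, a <= phi w <= b) ->
  expect (fun w => c + e * phi w) r k z w = c + e * expect phi r k z w.
Proof.
move=> phi_itv; elim: r k z w => [//|r IH] k z w /=.
under [in LHS]eq_fun do rewrite IH.
by apply: (@mean_affine _ _ a b) => i; exact: expect_itv.
Qed.

(** By induction, the moment over the later coordinates is at most a constant times the exponential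
    of t times their conditional mean. That mean oscillates by at most [osc (Var g) d r k] in the
    symbol at k, so Hoeffding's lemma adds one term to the sum. *)
Lemma expect_mgf (phi : (nat -> A) -> R) (a b : R) (d : nat -> R) (t : R)
    r k z w :
  (forall w, a <= phi w <= b) -> (forall k, 0 <= d k) ->
  (forall w k i j, phi (upd w k i) - phi (upd w k j) <= d k) ->
  expect (fun w => expR (t * phi w)) r k z w <=
  expR (t * expect phi r k z w +
        t ^+ 2 * (\sum_(i < r) osc (Var g) d (r - i.+1) (k + i) ^+ 2) / 8).
Proof.
move=> phi_itv d_ge0 phi_d.
elim: r k z w => [|r IH] k z w /=; first by rewrite big_ord0 mulr0 mul0r addr0.
rewrite big_ord_recl /= subSS subn0 addn0.
rewrite (_ : \sum_(i < r)
    osc (Var g) d (r.+1 - (bump 0 i).+1) (k + bump 0 i) ^+ 2 =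
  \sum_(i < r) osc (Var g) d (r - i.+1) (k.+1 + i) ^+ 2); last first.
  by apply: eq_bigr => i _; rewrite subSS /bump leq0n add1n addSnnS.
set S := \sum_(i < r) _.
(* The summand 0 gives the bound the form required by [mean_affine]. *)
have {}IH u v : expect (fun w => expR (t * phi w)) r k.+1 u v <=
    0 + expR (t ^+ 2 * S / 8) * expR (t * expect phi r k.+1 u v).
  by rewrite add0r -expRD [X in expR X]addrC; exact: IH.
pose H i := expect phi r k.+1 (push z i) (upd w k i).
have H_itv i : a <= H i <= b by exact: expect_itv.
have eH_itv i := expR_scale_itv t (H_itv i).
have osc_H i j : H i - H j <= osc (Var g) d r k.
  exact: (expect_osc phi_itv d_ge0 phi_d).
apply: (@le_trans _ _
    (mean z (fun i => 0 + expR (t ^+ 2 * S / 8) * expR (t * H i)))).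
  apply: (@le_mean _ _ _ 0 (expR (Num.max (t * a) (t * b))) 0
    (expR (t ^+ 2 * S / 8) * expR (Num.max (t * a) (t * b)))) => i.
  - by apply: expect_itv => v; exact: expR_scale_itv.
  - have /andP[e0 eb] := eH_itv i.
    by rewrite add0r mulr_ge0 ?expR_ge0//= ler_pM2l ?expR_gt0.
  - exact: IH.
rewrite (mean_affine _ _ _ eH_itv) add0r.
apply: le_trans (ler_wpM2l (expR_ge0 _) (mean_hoeffding_osc z t H_itv osc_H)) _.
rewrite -expRD le_eqVlt; apply/orP; left; apply/eqP; congr expR.
by rewrite /H; field.
Qed.

(** With no coordinate left, phi is constant on the cylinder; otherwise split by the symbol at k,
    each piece having its mass from [P_cyl_upd]. *)
Lemma integral_cyl (phi : (nat -> A) -> R) (b : R) x r k w :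
  prefix_dep (k + r) phi -> (forall w, 0 <= phi w <= b) ->
  (\int[P x]_(v in cyl w k) (phi v)%:E =
   P x (cyl w k) * (expect phi r k (concat x w k) w)%:E)%E.
Proof.
move=> + phi_itv; elim: r k w => [|r IH] k w phi_dep /=.
  transitivity (\int[P x]_(v in cyl w k) (cst (phi w)%:E) v)%E.
    apply: eq_integral => v; rewrite inE => vw; congr (_%:E).
    by apply: phi_dep => i; rewrite addn0; exact: vw.
  rewrite integral_cst; last exact: measurable_cyl.
  by rewrite muleC.
rewrite [in LHS]cyl_bigcup (ge0_integral_bigcup_esum (P x) A_countable);
  first last.
- by move=> v _; rewrite lee_fin; case/andP: (phi_itv v).
- rewrite -cyl_bigcup; apply/measurable_funTS/measurable_EFinP.
  exact: (measurable_prefix_fun A_countable phi_dep).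
- exact: trivIset_cyl.
- by move=> i; exact: measurable_cyl.
rewrite (@mean_esum _ _ b); last by move=> i; exact: expect_itv.
have [p p0 pE] : exists2 p : R, 0 <= p & P x (cyl w k) = p%:E.
  by rewrite P_cyl; eexists; last by []; apply: prodr_ge0 => j _; exact: g_ge0.
rewrite pE -esumZ//; last first.
  move=> i; rewrite lee_fin mulr_ge0 ?g_ge0//.
  by case/andP: (expect_itv phi_itv r k.+1 (push (concat x w k) i) (upd w k i)).
apply: eq_esum => i _; rewrite IH; last by rewrite addSnnS.
by rewrite P_cyl_upd pE concat_upd !EFinM -muleA muleCA.
Qed.

Lemma Rintegral_expect (phi : (nat -> A) -> R) (a b : R) x m w :
  prefix_dep m phi -> (forall w, a <= phi w <= b) ->
  \int[P x]_v phi v = expect phi m 0 x w.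
Proof.
move=> phi_dep phi_itv.
have mphi := measurable_prefix_fun A_countable phi_dep.
(* The shift makes the integrand nonnegative, as [integral_cyl] requires. *)
pose psi v := - a + 1 * phi v.
have psi_itv v : 0 <= psi v <= b - a.
  by rewrite /psi; have := phi_itv v; lra.
have psi_dep : prefix_dep (0 + m) psi.
  by move=> u v uv; rewrite /psi (phi_dep u v).
have := integral_cyl x w psi_dep psi_itv.
rewrite cyl0 concat0 probability_setT mul1e => /(congr1 fine)/=.
rewrite (expect_affine _ _ _ _ _ _ phi_itv) => h.
have := Rintegral_affine (P x) (- a) 1 mphi phi_itv; rewrite /Rintegral h.
by move/addrI; rewrite !mul1r => ->.
Qed.

End Specified.

(** * Concentration *)

Section SubGaussianTail.
Context {R : realType} d (T : measurableType d) (P : probability T R).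

Lemma subgaussian_upper_tail (X : T -> R) (a b C u : R) :
  measurable_fun setT X -> (forall w, a <= X w <= b) -> 0 < C -> 0 < u ->
  (forall t, \int[P]_w expR (t * X w) <= expR (t ^+ 2 * C / 8)) ->
  (P [set w | (u <= X w)%R] <= (expR (- (2 * u ^+ 2 / C)))%:E)%E.
Proof.
(* This t minimises t^2 C / 8 - t u, with minimum - 2 u^2 / C. *)
move=> mX Xab C0 u0 mgf; pose t := 4 * u / C.
have t0 : 0 < t by rewrite divr_gt0// mulr_gt0.
pose Y : {RV P >-> R} := mfun_Sub (mem_set mX : X \in mfun).
have metX : measurable_fun setT (fun w => expR (t * X w)).
  by apply: measurableT_comp => //; exact: measurable_funM.
have MY : 'M_P Y t = (\int[P]_w expR (t * X w))%:E.
  rewrite /mmt_gen_fun unlock /Rintegral fineK; last first.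
    apply: integrable_fin_num => //.
    apply: (bounded_integrable P metX) => w.
    exact: expR_scale_itv.
  by apply: eq_integral => w _ /=; rewrite mulrC.
apply: le_trans (chernoff Y u t0) _; rewrite MY -EFinM lee_fin.
apply: le_trans (ler_wpM2r (expR_ge0 _) (mgf t)) _.
rewrite -expRD le_eqVlt; apply/orP; left; apply/eqP; congr expR.
by rewrite /t; field; exact: lt0r_neq0.
Qed.

Lemma subgaussian_tail (X : T -> R) (a b C u : R) :
  measurable_fun setT X -> (forall w, a <= X w <= b) -> 0 < C -> 0 < u ->
  (forall t, \int[P]_w expR (t * X w) <= expR (t ^+ 2 * C / 8)) ->
  (P [set w | (u < `|X w|)%R] <= 2%:E * (expR (- (2 * u ^+ 2 / C)))%:E)%E.
Proof.
move=> mX Xab C0 u0 mgf.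
have mNX : measurable_fun setT (fun w => - X w) by exact: measurableT_comp.
have tail_up := subgaussian_upper_tail mX Xab C0 u0 mgf.
(* The moment bound is even in t, so - X satisfies it as well. *)
have tail_dn : (P [set w | (u <= - X w)%R] <= (expR (- (2 * u ^+ 2 / C)))%:E)%E.
  apply: (@subgaussian_upper_tail _ (- b) (- a)) => // [w|t].
    by rewrite !lerN2 andbC.
  rewrite -sqrrN; under eq_Rintegral do rewrite mulrN -mulNr.
  exact: mgf.
have mge (Z : T -> R) : measurable_fun setT Z -> measurable [set w | u <= Z w].
  move=> mZ; rewrite (_ : mkset _ = setT `&` Z @^-1` `[u, +oo[).
    exact: mZ.
  by apply/seteqP; split => w /=; rewrite in_itv/= andbT; [split|case].
rewrite (_ : 2%:E = 1 + 1)%E; last by rewrite -EFinD.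
rewrite ge0_muleDl// mul1e.
apply: le_trans (leeD tail_up tail_dn).
apply: le_trans (measureU2 _ (mge _ mX) (mge _ mNX)).
apply: le_measure; rewrite ?inE.
- rewrite (_ : mkset _ = setT `&` (fun w => `|X w|) @^-1` `]u, +oo[).
    by apply: measurableT_comp.
  by apply/seteqP; split => w /=; rewrite in_itv/= andbT; [split|case].
- exact: measurableU (mge _ mX) (mge _ mNX).
- by move=> w /=; rewrite ltr_normr => /orP[] /ltW; [left|right].
Qed.

End SubGaussianTail.

(** Replace the coordinates of w by [point] one at a time, each at a cost of at most [d k]. Thus
    finite oscillations already force boundedness, hence integrability. *)
Lemma prefix_dep_bounded (R : realType) (A : pointedType)
    (phi : (nat -> A) -> R) (d : nat -> R) (m : nat) :
  prefix_dep m phi ->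
  (forall w k i j, phi (upd w k i) - phi (upd w k j) <= d k) ->
  forall w, phi (fun=> point) - \sum_(k < m) d k <= phi w
            <= phi (fun=> point) + \sum_(k < m) d k.
Proof.
move=> phi_dep phi_d w.
pose mix k : nat -> A := fun i => if (i < k)%N then point else w i.
have mixS k : mix k.+1 = upd (mix k) k point.
  apply/funext => i; rewrite /mix /upd ltnS leq_eqVlt.
  by case: eqVneq.
have mixE k : mix k = upd (mix k) k (w k).
  apply/funext => i; rewrite /upd; case: eqVneq => // ->.
  by rewrite /mix ltnn.
have h k : phi w - \sum_(i < k) d i <= phi (mix k) <= phi w + \sum_(i < k) d i.
  elim: k => [|k /andP[lo up]].
    by rewrite big_ord0 subr0 addr0; have -> : mix 0%N = w by []; rewrite lexx.
  have := phi_d (mix k) k point (w k); have := phi_d (mix k) k (w k) point.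
  rewrite -mixS -mixE big_ord_recr/= => h1 h2.
  by apply/andP; split; lra.
have -> : phi (fun=> point) = phi (mix m).
  by apply: phi_dep => i im; rewrite /mix im.
by have /andP[lo up] := h m; apply/andP; split; lra.
Qed.

(** * The oscillations of f as a real sequence *)

Section Oscillation.
Context {R : realType} {A : pointedType} (n : nat) (f : ('I_n.+1 -> A) -> R).

(** Zero beyond n, where f ignores the trajectory, so that it bounds the effect of an update at any
    time. *)
Definition delta_at (k : nat) : R :=
  if (k < n.+1)%N then fine (delta f (inord k)) else 0.

Lemma delta_ge0 j : (0 <= delta f j)%E.
Proof.
apply: ereal_sup_ubound; exists (fun=> point), point, point.
by rewrite subrr normr0.
Qed.

Lemma delta_at_ge0 k : 0 <= delta_at k.
Proof.
by rewrite /delta_at; case: ifP => // _; rewrite fine_ge0// delta_ge0.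
Qed.

Hypothesis f_L : in_L f.

Lemma delta_fin j : delta f j \is a fin_num.
Proof. by rewrite ge0_fin_numE ?delta_ge0. Qed.

Lemma delta_norm2E : delta_norm2 f = (\sum_(k < n.+1) delta_at k ^+ 2)%:E.
Proof.
rewrite /delta_norm2 -sumEFin; apply: eq_bigr => k _.
by rewrite /delta_at ltn_ord inord_val EFin_expe fineK// delta_fin.
Qed.

Lemma on_traj_upd w k i j :
  on_traj f (upd w k i) - on_traj f (upd w k j) <= delta_at k.
Proof.
rewrite /delta_at /on_traj; case: ifPn => [kn|]; last first.
  rewrite -leqNgt => nk.
  rewrite (_ : (fun i0 => _) = fun m : 'I_n.+1 => upd w k j m) ?subrr//.
  by apply/funext => m; rewrite !upd_lt// (leq_trans _ nk).
have updE a : (fun m : 'I_n.+1 => upd w k a m) =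
    @dfwith _ (fun=> A) (fun m : 'I_n.+1 => w m) (inord k) a.
  apply/funext => m; have [<-|km] := eqVneq (inord k) m.
    by rewrite dfwithin inordK// upd_same.
  rewrite dfwithout// /upd ifN//; apply: contraNneq km => mk.
  by rewrite -mk inord_val.
rewrite !updE (le_trans (ler_norm _))// -lee_fin fineK ?delta_fin//.
by apply: ereal_sup_ubound; exists (fun m : 'I_n.+1 => w m), i, j.
Qed.

Lemma on_traj_prefix : prefix_dep n.+1 (on_traj f).
Proof.
by move=> w w' ww'; rewrite /on_traj; congr f; apply/funext => i; exact: ww'.
Qed.

End Oscillation.

Theorem theorem3p3 (R : realType) (A : pointedType)
    (A_countable : countable [set: A])
    (g : A -> past A -> R) (g_kernel : is_kernel g)
    (P : past A -> probability (trajectory A) R)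
    (P_spec : forall x : past A, specified_by g x (P x))
    (Gamma_gt0 : 0 < Gamma g)
    (n : nat) (f : ('I_n.+1 -> A) -> R) (f_L : in_L f) :
  (forall theta : R,
    (ereal_sup [set 'E_(P x)[(fun w : trajectory A =>
         expR (theta * (on_traj f w - fine 'E_(P x)[on_traj f])))]
       | x in [set: past A]]
     <= expeR ((theta ^+ 2 * Gamma g ^- 2 / 8)%:E * delta_norm2 f))%E) /\
  (forall u : R, 0 < u ->
    (ereal_sup [set P x [set w : trajectory A |
         (u < `|on_traj f w - fine 'E_(P x)[on_traj f]|)%R]
       | x in [set: past A]]
     <= 2%:E * expeR (- ((2 * u ^+ 2)%:E / ((Gamma g ^- 2)%:E * delta_norm2 f))))%E).
Proof.
have d_ge0 := delta_at_ge0 f; have f_dep := @on_traj_prefix R _ _ f.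
have f_d := on_traj_upd f_L.
have f_itv := prefix_dep_bounded f_dep f_d.
set S := \sum_(k < n.+1) delta_at f k in f_itv.
set c := on_traj f (fun=> point) in f_itv.
rewrite (delta_norm2E f_L).
set D := \sum_(k < n.+1) delta_at f k ^+ 2.
have mf : measurable_fun setT (on_traj f).
  exact: (measurable_prefix_fun A_countable f_dep).
pose m x := \int[P x]_w on_traj f w.
have mE x : fine 'E_(P x)[on_traj f] = m x by rewrite unlock.
have X_itv x w : (c - S) - m x <= on_traj f w - m x <= (c + S) - m x.
  by rewrite !lerD2r.
have mX x : measurable_fun setT (fun w => on_traj f w - m x).
  by apply: measurable_funB.
(* Centring contributes the factor [expR (- (t * m x))], which cancels the mean in [expect_mgf];
   Young's inequality with C = 1 / Gamma bounds what remains. *)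
have mgf x t :
    \int[P x]_w expR (t * (on_traj f w - m x)) <=
    expR (t ^+ 2 * (Gamma g ^- 2 * D) / 8).
  have -> : \int[P x]_w expR (t * (on_traj f w - m x)) =
      \int[P x]_w (0 + expR (- (t * m x)) * expR (t * on_traj f w)).
    by apply: eq_Rintegral => w _; rewrite add0r -expRD mulrBr addrC.
  rewrite (@Rintegral_affine _ _ _ _ _ 0
    (expR (Num.max (t * (c - S)) (t * (c + S))))); last 2 first.
  - apply: measurableT_comp => //; exact: measurable_funM.
  - by move=> w; exact: expR_scale_itv.
  have eh_dep : prefix_dep n.+1 (fun w => expR (t * on_traj f w)).
    by move=> w w' ww'; rewrite (f_dep w w').
  have RE := Rintegral_expect A_countable g_kernel P_spec x (fun=> point).
  rewrite add0r (RE _ _ _ _ eh_dep (fun w => expR_scale_itv t (f_itv w))).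
  have := expect_mgf A_countable g_kernel P_spec t n.+1 0 x (fun=> point)
    f_itv d_ge0 f_d.
  move=> /(ler_wpM2l (expR_ge0 (- (t * m x)))) h; apply: le_trans h _.
  rewrite -expRD ler_expR -(RE _ _ _ _ f_dep f_itv).
  rewrite -/(m x) addKr ler_pM2r ?invr_gt0// ler_wpM2l ?sqr_ge0//.
  have := sum_osc_sqr_le (Var_itv g_kernel) (delta_at f) n
    (fun N => sum_visit_le_Gamma g_kernel N Gamma_gt0).
  rewrite exprVn; apply: le_trans.
  rewrite le_eqVlt; apply/orP; left; apply/eqP; apply: eq_bigr => i _.
  by rewrite subSS add0n.
split => [theta|u u0]; apply: ge_ereal_sup => _ [x _ <-]; rewrite mE.
  have metX := measurableT_comp (@measurable_expR R)
    (measurable_funM (measurable_cst theta) (mX x)).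
  rewrite unlock (_ : \int[P x]_w _ = (\int[P x]_w expR (theta *
    (on_traj f w - m x)))%:E)%E; last first.
    rewrite /Rintegral fineK// integrable_fin_num//.
    apply: (@bounded_integrable _ _ _ (P x) _ 0 _ metX) => w.
    exact: (expR_scale_itv theta (X_itv x w)).
  rewrite -EFinM lee_fin (_ : _ * D = theta ^+ 2 * (Gamma g ^- 2 * D) / 8).
    exact: mgf.
  by field; exact: lt0r_neq0.
have D_ge0 : 0 <= D by apply: sumr_ge0 => k _; exact: sqr_ge0.
(* When D = 0 the exponent divides by zero; f is then constant and the event empty. *)
have [D0|D_neq0] := eqVneq D 0.
  have d0 (k : 'I_n.+1) : delta_at f k = 0.
    have := @psumr_eq0P _ _ predT (fun i : 'I_n.+1 => delta_at f i ^+ 2)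
      (fun i _ => sqr_ge0 _) D0 k isT.
    by move/eqP; rewrite sqrf_eq0 => /eqP.
  have S0 : S = 0 by rewrite /S big1// => k _; exact: d0.
  have fE w : on_traj f w = c.
    have := f_itv w; rewrite S0 subr0 addr0 => h.
    by apply/le_anti; rewrite andbC.
  rewrite (_ : [set w | _] = set0) ?measure0.
    by rewrite mule_ge0// expeR_ge0.
  rewrite -subset0 => w /=; rewrite fE /m.
  under eq_Rintegral do rewrite fE.
  by rewrite Rintegral_prob_cst subrr normr0 ltNge (ltW u0).
have C0 : 0 < Gamma g ^- 2 * D.
  by rewrite mulr_gt0 ?invr_gt0 ?exprn_gt0// lt0r D_neq0.
apply: le_trans (subgaussian_tail (mX x) (X_itv x) C0 u0 (mgf x)) _.
by rewrite -EFinM inver gt_eqF.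
Qed.
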